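(* Let $L,N\in\mathbb{R}_{\ge0}$, $T\in\mathbb{R}_{>0}$, $k,m\in\mathbb{N}$, $k\le m$, and consider a causal differentiator $\mathcal{D}$ of order $m$. Then its worst-case error satisfies a) $M_{N,k}^{\mathcal{F}_{L,\mathbf{R}}^m}(t)\ge\lim_{\tau\to\infty}\bar g_{N,k}^{m,L}(\tau)$ for all $\mathbf{R}\in\mathbb{R}_{\ge0}^{m+1}$ and $t\in\mathbb{R}_{\ge0}$; b) $M_{N,k}^{\mathcal{F}_{L,\mathbf{R}}^m}(t)\ge\bar g_{N,k}^{m,L}(t)$ for each $\theta\in\mathbb{R}_{>0}$, all $\mathbf{R}\in\mathbb{R}_{\ge0}^{m+1}$ with $\mathbf{R}\ge\big(N,\bar g_{N,1}^{m,L}(\theta),\dots,\bar g_{N,m}^{m,L}(\theta)\big)$ componentwise, and all $t\ge\theta$; c) $M_{N,k}^{\mathcal{F}_L^m}(t)\ge\bar g_{N,k}^{m,L}(t)$ for all $t\in\mathbb{R}_{>0}$.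
   Context: For $m\in\mathbb{N}_0$ and $L,N\ge 0$: $\mathcal{F}^m$ is the set of functions $f:\mathbb{R}_{\ge 0}\to\mathbb{R}$ that are $m$ times continuously differentiable with $f^{(m)}$ Lipschitz continuous; $\mathcal{F}_L^m=\{f\in\mathcal{F}^m: |f^{(m+1)}(t)|\le L\text{ a.e. on }\mathbb{R}_{\ge0}\}$; $\mathcal{E}_N=\{\eta:\mathbb{R}_{\ge0}\to\mathbb{R}: |\eta(t)|\le N\text{ for all }t\ge0\}$; $\mathcal{F}_L^m+\mathcal{E}_N=\{f+\eta: f\in\mathcal{F}_L^m,\eta\in\mathcal{E}_N\}$; and $\mathcal{U}=\bigcup_{m\in\mathbb{N}_0,\,L,N\ge0}(\mathcal{F}_L^m+\mathcal{E}_N)$. For $\mathbf{R}=(R_0,\dots,R_m)\in\mathbb{R}_{\ge0}^{m+1}$, $\mathcal{F}_{L,\mathbf{R}}^m=\{f\in\mathcal{F}_L^m:|f^{(i)}(0)|\le R_i,\ i=0,\dots,m\}$. Here $f^{(0)}=f$ and derivatives at $0$ are one-sided. A differentiator of order $m$ is an operator $\mathcal{D}:\mathcal{U}\to(\mathbb{R}_{\ge0}\to\mathbb{R}^m)$, with components $\mathcal{D}_1,\dots,\mathcal{D}_m$. It is causal if for all $t\ge0$, $[\mathcal{D}u_1](t)=[\mathcal{D}u_2](t)$ whenever $u_1=u_2$ on $[0,t]$. Worst-case error over a signal class $\mathcal{S}\subseteq\mathcal{F}_L^m$: $M_{N,i}^{\mathcal{S}}(t)=\sup_{f\in\mathcal{S},\,\eta\in\mathcal{E}_N}\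 \sup_{\tau\ge t}|f^{(i)}(\tau)-[\mathcal{D}_i(f+\eta)](\tau)|\in[0,\infty]$. For $T>0$, $\mathcal{G}^m_{L,N}(T)=\{g\in\mathcal{F}_L^m:|g(t)|\le N\text{ for all }t\in[0,T]\}$ and $\bar g^{m,L}_{N,k}(T)=\sup\{g^{(k)}(T):g\in\mathcal{G}^m_{L,N}(T)\}$. *)

(* Defs.v *)
From mathcomp Require Import all_boot all_order all_algebra.
From mathcomp Require Import all_classical all_reals all_analysis.

Set Implicit Arguments.
Unset Strict Implicit.
Unset Printing Implicit Defensive.

Import Order.TTheory GRing.Theory Num.Theory.
Import numFieldNormedType.Exports.

Local Open Scope classical_set_scope.
Local Open Scope ring_scope.

(** A function on the half-line [0, +oo[ is represented by a function [R -> R]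
    of which only the values at nonnegative arguments are constrained.  All
    notions below refer to nonnegative arguments only; in particular [causal]
    forces a differentiator to ignore the values of its input at negative
    arguments. *)

Section HalfLineDerivative.
Context {R : realType}.
Implicit Types (f : R -> R) (t : R).

Definition hquot f t (s : R) : R := (f s - f t) / (s - t).

(** The limit is taken over s in [0, +oo[, s != t: it is the usual derivative
    at t > 0 and the right derivative at t = 0. *)
Definition hderivable f t : Prop :=
  cvg (hquot f t s @[s --> within `[0, +oo[ t^']).

Definition hderive f t : R := lim (hquot f t s @[s --> within `[0, +oo[ t^']).

Definition hderiven (k : nat) f : R -> R := iter k hderive f.

End HalfLineDerivative.

Section SignalClasses.
Context {R : realType}.

Definition smooth_lip (m : nat) : set (R -> R) :=
  [set f | [/\ forall (k : nat) (t : R), (k < m)%N -> 0 <= t -> hderivable (hderiven k f) t,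
               {within `[0, +oo[, continuous (hderiven m f)}
             & exists K : R, K.-lipschitz_(`[0, +oo[) (hderiven m f)]].

(** The derivative of order m + 1 exists almost everywhere for every member of
    [smooth_lip m] (Rademacher); existence is repeated next to the bound because
    [hderive] has an arbitrary value where the limit does not exist. *)
Definition classF (m : nat) (L : R) : set (R -> R) :=
  [set f | smooth_lip m f /\
           {ae lebesgue_measure, forall t : R, 0 <= t ->
              hderivable (hderiven m f) t /\ `|hderiven m.+1 f t| <= L}].

Definition classFR (m : nat) (L : R) (r : 'I_m.+1 -> R) : set (R -> R) :=
  [set f | classF m L f /\ forall i : 'I_m.+1, `|hderiven i f 0| <= r i].

Definition noise (N : R) : set (R -> R) :=
  [set eta | forall t : R, 0 <= t -> `|eta t| <= N].

Definition inputs : set (R -> R) :=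
  [set u | exists m L N, [/\ 0 <= L, 0 <= N &
     exists f eta, [/\ classF m L f, noise N eta & u = f \+ eta]]].

End SignalClasses.

Section Differentiators.
Context {R : realType}.

(** Operators are total; their values outside [inputs] are irrelevant.  The
    component estimating the derivative of order i + 1 has index i : 'I_m. *)
Definition differentiator (m : nat) : Type := (R -> R) -> R -> 'rV[R]_m.

Definition causal (m : nat) (D : differentiator m) : Prop :=
  forall (t : R) (u1 u2 : R -> R), 0 <= t -> inputs u1 -> inputs u2 ->
    (forall s, 0 <= s <= t -> u1 s = u2 s) -> D u1 t = D u2 t.

(** [worst_case_error D C N k t] concerns the derivative of order k + 1. *)
Definition worst_case_error (m : nat) (D : differentiator m)
    (C : set (R -> R)) (N : R) (k : 'I_m) (t : R) : \bar R :=
  ereal_sup [set ereal_sup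
      [set (`|hderiven k.+1 p.1 tau - D (p.1 \+ p.2) tau ord0 k|)%:E
        | tau in [set tau | t <= tau]]
    | p in C `*` noise N].

Definition classG (m : nat) (L N T : R) : set (R -> R) :=
  [set g | classF m L g /\ forall t : R, 0 <= t <= T -> `|g t| <= N].

Definition gbar (m : nat) (L N : R) (k : nat) (T : R) : \bar R :=
  ereal_sup [set (hderiven k g T)%:E | g in classG m L N T].

End Differentiators.

Arguments differentiator R m : clear implicits.

(* Main.v *)
(* Two signals f and - f with noises - f and f on [0, tau] give the same zero
   input up to time tau, so a causal operator errs by at least |f^(k)(tau)| on one
   of them, provided |f| <= N on [0, tau] and both signals are admissible.  For c)
   this is all.  For b), reflecting g in G(theta) about theta / 2 shows that
   |g^(i)(0)| <= gbar_i(theta), so g is admissible.  For a), where the initial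
   derivatives may have to vanish, a signal g in G(T) is replaced on [0, T] by
   lambda (x / T)^(m+1) g, with lambda = L / (L + O(1 / T)); by a Landau inequality
   this changes the bound on the derivative of order m + 1 and the value of g^(k)(T)
   by O(1 / T) only.  For L = 0 the Landau inequality gives gbar_k(T) -> 0. *)

Require Import Defs.
From mathcomp Require Import all_boot all_order all_algebra.
From mathcomp Require Import all_classical all_reals all_analysis.
From mathcomp Require Import measurable_realfun ring lra.
Import Order.TTheory GRing.Theory Num.Theory.
Import numFieldNormedType.Exports.
Local Open Scope classical_set_scope.
Local Open Scope ring_scope.
Set Implicit Arguments.
Unset Strict Implicit.
Unset Printing Implicit Defensive.

(** * Derivatives *)

Section Derivatives.
Context {R : realType}.
Implicit Types (f g w : R -> R) (x t l : R).

(* With [A := setT] this is the two-sided derivative, with [A := `[0, +oo[] the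
   half-line derivative [hderive]. *)
Definition expansion (A : set R) f x l : Prop :=
  forall e : R, 0 < e -> exists2 d : R, 0 < d & forall y, A y -> `|y - x| < d ->
    `|f y - f x - l * (y - x)| <= e * `|y - x|.

(** The first-order form has no quotient and holds trivially at [y = x], so restricting the domain
    or changing the function away from [x] needs no argument about filters. *)
Lemma quotient_expansion (A : set R) f x l :
  (f s - f x) / (s - x) @[s --> within A x^'] --> l <-> expansion A f x l.
Proof.
split=> [/cvgrPdist_le h e /h|h].
- case=> d /= d0 dP; exists d => // y Ay yd.
  have [->|yx] := eqVneq y x; first by rewrite !subrr mulr0 subr0 normr0 mulr0.
  have yx0 : y - x != 0 by rewrite subr_eq0.
  have -> : f y - f x - l * (y - x) = - (l - (f y - f x) / (y - x)) * (y - x).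
    by field.
  rewrite normrM normrN ler_wpM2r//; apply: dP => //=.
  by rewrite distrC.
- apply/cvgrPdist_le => e /h[d d0 dP]; exists d => //= y /= xy yx Ay.
  have yx0 : y - x != 0 by rewrite subr_eq0.
  have -> : l - (f y - f x) / (y - x) = - (f y - f x - l * (y - x)) / (y - x).
    by field.
  rewrite normrM normrN normfV ler_pdivrMr ?normr_gt0//; apply: dP => //.
  by rewrite distrC.
Qed.

Lemma is_derive_expansion f x l : is_derive x 1 f l <-> expansion setT f x l.
Proof.
have H : (h^-1 *: (f (h *: 1 + x) - f x) @[h --> 0^'] --> l) <->
    expansion setT f x l.
  split=> [/cvgrPdist_le h e /h|h].
  - case=> d /= d0 dP; exists d => // y Ay yd.
    have [->|yx] := eqVneq y x; first by rewrite !subrr mulr0 subr0 normr0 mulr0.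
    have yx0 : y - x != 0 by rewrite subr_eq0.
    have -> : f y - f x - l * (y - x) = - (l - (y - x)^-1 * (f y - f x)) * (y - x).
      by field.
    rewrite normrM normrN ler_wpM2r//; have := dP (y - x).
    rewrite /= /ball/= sub0r normrN /GRing.scale/= mulr1 subrK; exact.
  - apply/cvgrPdist_le => e /h[d d0 dP]; exists d => //= y /=.
    rewrite sub0r normrN => yd y0.
    rewrite /GRing.scale/= mulr1.
    have -> : l - y^-1 * (f (y + x) - f x) = - (f (y + x) - f x - l * (y + x - x)) / y.
      by field.
    rewrite normrM normrN normfV ler_pdivrMr ?normr_gt0//.
    by have := dP (y + x) I; rewrite addrK; exact.
split=> [[d1 d2]|/H h].
- apply/H; rewrite -d2; exact: d1.
- split; first by apply/cvg_ex; exists l.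
  exact/cvg_lim.
Qed.

Lemma expansionS (A B : set R) f x l :
  A `<=` B -> expansion B f x l -> expansion A f x l.
Proof. by move=> AB h e /h[d d0 dP]; exists d => // y /AB; exact: dP. Qed.

Lemma expansion_ge0 f x l : 0 < x ->
  expansion `[0, +oo[ f x l -> expansion setT f x l.
Proof.
(* A radius of at most [x] keeps the ball inside the half-line. *)
move=> x0 h e /h[d d0 dP]; exists (Num.min d x); first by rewrite lt_min d0.
move=> y _; rewrite lt_min => /andP[yd yx]; apply: dP => //=.
by rewrite in_itv/= andbT; move: yx; rewrite ltr_norml => /andP[+ _]; lra.
Qed.

Lemma eq_expansion (A : set R) f g x l : A x -> {in A, f =1 g} ->
  expansion A f x l -> expansion A g x l.
Proof.
move=> Ax fg h e /h[d d0 dP]; exists d => // y Ay yd.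
by rewrite -!fg ?inE//; exact: dP.
Qed.

Lemma is_derive_near f g x l (d : R) : 0 < d ->
  (forall y, `|y - x| < d -> f y = g y) -> is_derive x 1 f l -> is_derive x 1 g l.
Proof.
move=> d0 fg /is_derive_expansion h; apply/is_derive_expansion => e /h[d1 d10 dP].
exists (Num.min d d1); first by rewrite lt_min d0.
move=> y _; rewrite lt_min => /andP[yd yd1]; rewrite -!fg//; first exact: dP.
by rewrite subrr normr0.
Qed.

(** Needed for uniqueness of the limit in [hderive]. Points to the right of [t] are always
    available, also at [t = 0]. *)
Lemma proper_within_ge0 t : 0 <= t -> ProperFilter (within `[0, +oo[ t^').
Proof.
move=> t0; apply: Build_ProperFilter_ex => P [d /= d0 dP].
exists (t + d / 2); apply: dP => /=.
- by rewrite opprD addrA subrr sub0r normrN gtr0_norm ?divr_gt0//; lra.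
- by rewrite addrC -subr_eq0 addrK gt_eqF ?divr_gt0.
- by rewrite in_itv/= andbT addr_ge0// divr_ge0// ltW.
Qed.

Lemma hderive_expansion f t l : 0 <= t -> expansion `[0, +oo[ f t l ->
  hderivable f t /\ hderive f t = l.
Proof.
move=> t0 /quotient_expansion h; split; first by apply/cvg_ex; exists l.
by have := proper_within_ge0 t0 => ?; apply/cvg_lim.
Qed.

Lemma hderivable_expansion f t : hderivable f t ->
  expansion `[0, +oo[ f t (hderive f t).
Proof. by move=> /quotient_expansion. Qed.

Lemma eq_hquot_cvg f g t l : 0 <= t -> (forall s, 0 <= s -> f s = g s) ->
  hquot f t s @[s --> within `[0, +oo[ t^'] --> l ->
  hquot g t s @[s --> within `[0, +oo[ t^'] --> l.
Proof.
move=> t0 fg /quotient_expansion h; apply/quotient_expansion.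
apply: eq_expansion h; first by rewrite /= in_itv/= t0.
by move=> s; rewrite inE/= in_itv/= andbT => /fg.
Qed.

Lemma eq_hderivable f g t : 0 <= t -> (forall s, 0 <= s -> f s = g s) ->
  hderivable f t -> hderivable g t.
Proof. by move=> t0 fg /cvg_ex[l fl]; apply/cvg_ex; exists l; exact: eq_hquot_cvg fl. Qed.

(** No derivability is assumed: both quotients have the same set of limits, so [lim] chooses the
    same value, the default one included. *)
Lemma eq_hderive f g t : 0 <= t -> (forall s, 0 <= s -> f s = g s) ->
  hderive f t = hderive g t.
Proof.
move=> t0 fg; rewrite /hderive /lim/=; congr xget; apply/funext => l.
by apply/propext; split; apply: eq_hquot_cvg => // s /fg.
Qed.

Lemma is_derive_expansion_ge0 f t l : is_derive t 1 f l ->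
  expansion `[0, +oo[ f t l.
Proof. by move=> /is_derive_expansion; exact: expansionS. Qed.

Lemma is_derive_continuous f x l : is_derive x 1 f l -> {for x, continuous f}.
Proof. by move=> [+ _] => /derivable1_diffP/differentiable_continuous. Qed.

End Derivatives.

(** * Primitives of continuous functions and mean value bounds *)

Section Primitives.
Context {R : realType}.
Implicit Types (f g w : R -> R) (x t l : R).

Lemma is_derive_reflect f c x l : is_derive (c - x) 1 f l ->
  is_derive x 1 (fun s => f (c - s)) (- l).
Proof.
move=> /is_derive_expansion h; apply/is_derive_expansion => e /h[d d0 dP].
exists d => // y _ yd; have := dP (c - y) I.
have -> : c - y - (c - x) = - (y - x) by ring.
by rewrite normrN mulrN mulNr => /(_ yd).
Qed.

(** Integrate from -1. Near a negative argument the integral is 0, like [w]; for the other arguments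
    -1 lies strictly to the left, so the fundamental theorem of calculus applies. *)
Lemma primitive_half_line w : continuous w -> (forall s, s <= 0 -> w s = 0) ->
  exists F, forall x, is_derive x 1 F (w x).
Proof.
move=> cw w0; pose F (x : R) := (\int[lebesgue_measure]_(t in `[(-1)%R, x]) (w t))%R.
exists F => x.
have [x0|x0] := ltP x 0.
  rewrite w0 ?ltW//; apply: (@is_derive_near _ (cst 0) _ _ _ (- x)).
  - by rewrite oppr_gt0.
  - move=> y; rewrite ltr_norml => /andP[_ yx].
    have y0 : y < 0 by lra.
    rewrite /F (@eq_Rintegral _ _ _ _ _ (cst 0)) ?Rintegral_cst ?mul0r//.
    move=> s; rewrite inE/= in_itv/= => /andP[_ sy].
    by rewrite w0// (le_trans sy)// ltW.
have xx1 : x < x + 1 by rewrite ltrDl.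
have iw : lebesgue_measure.-integrable `[(-1)%R, x + 1] (EFin \o w).
  apply: continuous_compact_integrable; first exact: segment_compact.
  exact: continuous_subspaceT.
have x1 : -1 < x by rewrite (lt_le_trans _ x0)// ltrN10.
have [dF <-] := continuous_FTC1_closed xx1 iw x1 (cw x).
by rewrite derive1E; exact: derivableP.
Qed.

Lemma primitive w c : continuous w ->
  exists2 F, F 0 = c & forall x, is_derive x 1 F (w x).
Proof.
move=> cw.
(* Decompose [w x] as [w 0 + p x + q (- x)], where [p] and [q] vanish on the negative half-line; the
   second part is integrated after a reflection. *)
pose p (s : R) := w (Num.max s 0) - w 0.
pose q (s : R) := w (Num.min (0 - s) 0) - w 0.
have cmax (h : R -> R) : continuous h -> continuous (fun s => w (h s) - w 0).
  by move=> ch x; apply: cvgB; [apply: continuous_comp; [exact: ch|exact: cw]|exact: cvg_cst].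
have [|s s0|P dP] := @primitive_half_line p.
- apply: (cmax (fun s => Num.max s 0)) => x.
  by apply: (@continuous_max _ _ id (cst 0)) => //; exact: cvg_cst.
- by rewrite /p max_r// subrr.
have [|s s0|Q dQ] := @primitive_half_line q.
- apply: (cmax (fun s => Num.min (0 - s) 0)) => x.
  apply: (@continuous_min _ _ (fun s => 0 - s) (cst 0)).
    by apply: cvgB; [exact: cvg_cst|exact: cvg_id].
  exact: cvg_cst.
- by rewrite /q min_r ?subrr// sub0r oppr_ge0.
pose F0 (s : R) := P s - Q (0 - s) + w 0 * s.
exists (fun s => F0 s + (c - F0 0)); first by rewrite addrC subrK.
move=> x; have d1 := dP x; have d2 := is_derive_reflect (dQ (0 - x)).
have -> : (fun s => F0 s + (c - F0 0)) =
    (P - (fun s => Q (0 - s)) + w 0 \*: id) + cst (c - F0 0).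
  by apply/funext => s.
apply: is_derive_eq.
rewrite /q /p /GRing.scale/= opprK mulr1 addr0 (_ : 0 - (0 - x) = x); last by ring.
by have [x0|x0] := leP x 0; ring.
Qed.

Lemma derive_bound f (df : R -> R) (a b C : R) : a <= b ->
  (forall x, x \in `[a, b] -> is_derive x 1 f (df x)) ->
  (forall x, x \in `[a, b] -> `|df x| <= C) ->
  `|f b - f a| <= C * (b - a).
Proof.
move=> ab dfx dfC.
have fc : {within `[a, b], continuous f}.
  by apply: derivable_within_continuous => x /dfx[].
have fd x : x \in `]a, b[ -> is_derive x 1 f (df x).
  by move=> xab; apply: dfx; exact: subset_itv_oo_cc xab.
have [c cab fE] := MVT_segment ab fd fc.
by rewrite fE normrM [`|b - a|]ger0_norm ?subr_ge0// ler_wpM2r ?subr_ge0// dfC.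
Qed.

Lemma derive0_ge0_cst f x : expansion `[0, +oo[ f 0 0 ->
  (forall t, 0 < t -> is_derive t 1 f 0) -> 0 <= x -> f x = f 0.
Proof.
move=> f0 df; rewrite le_eqVlt => /predU1P[<-//|x0].
have fd t : t \in `]0, x[ -> is_derive t 1 f (cst 0 t).
  by rewrite in_itv/= => /andP[t0 _]; exact: df.
suff fc : {within `[0, x], continuous f}.
  have [c _ /eqP] := MVT x0 fd fc.
  by rewrite mul0r subr_eq0 => /eqP.
apply/continuous_within_itvP => //; split.
- by move=> t; rewrite in_itv/= => /andP[t0 _]; exact: is_derive_continuous (df _ t0).
(* With slope 0 and tolerance 1 the expansion gives [|f t - f 0| <= t] near 0, hence right
   continuity. *)
- apply/cvgrPdist_le => e e0; have [d d0 dP] := f0 1 ltr01.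
  exists (Num.min d e); first by rewrite /= lt_min d0.
  move=> t /=; rewrite lt_min distrC => /andP[td te] t0.
  have := dP t; rewrite /= in_itv/= (ltW t0) => /(_ isT td).
  by rewrite mul0r subr0 mul1r distrC => /le_trans; apply; rewrite ltW.
- apply: cvg_at_left_filter; exact: is_derive_continuous (df _ x0).
Qed.

End Primitives.

(** * Lipschitz functions with an almost everywhere bounded derivative *)

Section AlmostEverywhere.
Context {R : realType}.
Implicit Types (f g w h : R -> R) (x t l : R).

(** Let [c] be the supremum of the points up to which [h] stays below [h a]. The second hypothesis
    gives [h c <= h a]; if [c < b], the first one moves past [c], a contradiction. *)
Lemma real_induction h (a b : R) : a <= b ->
  (forall c, a <= c < b ->
    exists2 d, 0 < d & forall y, c <= y <= c + d -> h y <= h c) ->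
  (forall c, a < c <= b -> (forall y, a <= y < c -> h y <= h a) -> h c <= h a) ->
  h b <= h a.
Proof.
move=> ab hstep hleft.
pose E := [set x | a <= x <= b /\ forall y, a <= y <= x -> h y <= h a].
have Ea : E a by split; [rewrite lexx|move=> y; rewrite -eq_le => /eqP ->].
have supE : has_sup E by split; [exists a|exists b => x [/andP[]]].
pose c := sup E.
have ac : a <= c by apply: ub_le_sup => //; exact: supE.2.
have cb : c <= b by apply: sup_le_ub; [exists a|move=> x [/andP[]]].
have below y : a <= y < c -> h y <= h a.
  move=> /andP[ay yc]; have [x [xab Ex] yx] := sup_adherent (ltac:(by rewrite subr_gt0) : 0 < c - y) supE.
  by apply: Ex; rewrite ay ltW//; move: yx; rewrite -/c; lra.
have hc : h c <= h a.
  have [->//|ca] := eqVneq c a; apply: hleft => //.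
  by rewrite cb lt_neqAle eq_sym ca ac.
have [<-//|cb'] := eqVneq c b.
have cltb : c < b by rewrite lt_neqAle cb' cb.
have [|d d0 dP] := hstep c; first by rewrite ac.
suff : E (Num.min (c + d) b).
  move=> /(ub_le_sup supE.2); rewrite -/c leNgt lt_min cltb andbT ltrDl d0//.
split.
  rewrite ge_min lexx orbT andbT le_min ab andbT.
  by rewrite (le_trans ac)// lerDl ltW.
move=> y /andP[ay]; rewrite le_min => /andP[ycd yb].
have [yc|cy] := ltP y c; first by apply: below; rewrite ay.
by apply: le_trans hc; apply: dP; rewrite cy.
Qed.

(* [h] below does not increase: off a small open neighbourhood [U] of the
   exceptional set because of the derivative bound, and on [U] because the term
   [K * s x], with [s x] the measure of [U] before [x], absorbs the increments. *)
Lemma ae_derive_le w (K L a b : R) : 0 <= L -> a <= b ->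
  (forall x y, `|w x - w y| <= K * `|x - y|) ->
  {ae lebesgue_measure, forall x, exists2 l, is_derive x 1 w l & l <= L} ->
  w b - w a <= L * (b - a).
Proof.
move=> L0 ab wK [A [mA A0 NA]].
have K0 : 0 <= K by have := wK 1 0; rewrite subr0 normr1 mulr1; apply: le_trans.
apply/ler_addgt0Pr => e e0.
(* The final error is at most [r * (b - a) + K * r]; the extra 1 keeps the denominator positive. *)
pose r := e / (b - a + K + 1).
have D0 : 0 < b - a + K + 1 by lra.
have r0 : 0 < r by rewrite divr_gt0.
have [|U [oU AU muU]] := lebesgue_regularity_outer mA _ r0.
  by rewrite [X in (X < _)%E]A0.
have mU : measurable U by exact: open_measurable.
have {}muU : (lebesgue_measure U < r%:E)%E.
  rewrite -(setDUK AU) setUC measureU0//; exact: measurableD.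
pose S x := U `&` `[a, x].
have mS x : measurable (S x) by apply: measurableI => //; exact: measurable_itv.
have SU x : (lebesgue_measure (S x) <= lebesgue_measure U)%E.
  by rewrite le_measure ?inE//; [exact: mS|exact: subIsetl].
have Sfin x : lebesgue_measure (S x) \is a fin_num.
  by rewrite ge0_fin_numE// (le_lt_trans (SU x))// (lt_trans muU)// ltry.
pose s x := fine (lebesgue_measure (S x)).
have s_mono x y : x <= y -> s x <= s y.
  move=> xy; apply: fine_le => //; rewrite le_measure ?inE//; [exact: mS|exact: mS|].
  by apply: setIS; apply: subset_itvl; rewrite bnd_simp.
(* Across an interval inside [U], [s] grows by the full length, which pays for an increment of [w]
   of at most [K * (y - x)]. *)
have s_U x y : a <= x -> x <= y -> `]x, y] `<=` U -> s x + (y - x) <= s y.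
  move=> ax xy xyU.
  rewrite -lee_fin EFinD !fineK//.
  have -> : (y - x)%:E = lebesgue_measure `]x, y].
    rewrite lebesgue_measure_itv/= lte_fin; case: ltP => // yx.
    by rewrite (_ : y = x) ?subrr//; apply/eqP; rewrite eq_le yx xy.
  have mxy : measurable `]x, y] by exact: measurable_itv.
  have dxy : S x `&` `]x, y] = set0.
    rewrite -subset0 => z [[_]]; rewrite /= !in_itv/= => /andP[_ zx] /andP[].
    by rewrite ltNge zx.
  have := @measureU _ _ _ lebesgue_measure _ _ (mS x) mxy dxy.
  rewrite [X in _ = X -> _](_ : _ = lebesgue_measure (S x) + lebesgue_measure `]x, y])%E// => <-.
  rewrite le_measure ?inE//; [by apply: measurableU => //; exact: mS|exact: mS|].
  move=> z [[Uz]|xz].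
    rewrite /= in_itv/= => /andP[az zx]; split => //=.
    by rewrite in_itv/= az (le_trans zx).
  split; first exact: xyU.
  move: xz; rewrite /= !in_itv/= => /andP[xz ->].
  by rewrite (le_trans ax)// ltW.
pose h x := w x - (L + r) * x - K * s x.
have : h b <= h a.
  apply: real_induction => // c /andP[].
  - move=> ac cb; have [Uc|NUc] := pselect (U c).
      move: oU; rewrite openE => /(_ _ Uc)[d /= d0 dU].
      exists (d / 2); first by rewrite divr_gt0.
      move=> y /andP[cy yd].
      have cyU : `]c, y] `<=` U.
        move=> z; rewrite /= in_itv/= => /andP[cz zy]; apply: dU.
        by rewrite /ball/= ltr0_norm ?subr_lt0//; lra.
      have := s_U _ _ ac cy cyU => /(ler_wpM2l K0).
      have Lr0 : 0 <= (L + r) * (y - c) by rewrite mulr_ge0 ?subr_ge0 ?addr_ge0// ltW.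
      have := wK y c; rewrite [`|y - c|]ger0_norm ?subr_ge0// ler_norml => /andP[_].
      by rewrite /h; lra.
    have [l /is_derive_expansion wl lL] : exists2 l, is_derive c 1 w l & l <= L.
      by apply: contrapT => /NA /AU.
    have [d d0 dP] := wl _ r0; exists (d / 2); first by rewrite divr_gt0.
    move=> y /andP[cy yd]; have := dP y I; rewrite [`|y - c|]ger0_norm ?subr_ge0//.
    have -> : y - c < d by lra.
    move=> /(_ isT); rewrite ler_norml => /andP[_ wy].
    have := s_mono _ _ cy; rewrite -subr_ge0 => /(mulr_ge0 K0).
    have : 0 <= (L - l) * (y - c) by rewrite mulr_ge0 ?subr_ge0.
    by rewrite /h; lra.
  - move=> ac cb hy; apply/ler_addgt0Pr => q q0.
    have K1 : 0 < K + 1 by lra.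
    pose p := q / (K + 1); have p0 : 0 < p by rewrite divr_gt0.
    have pK : p * (K + 1) = q by rewrite /p mulfVK// gt_eqF.
    (* A point of [[a, c[] at distance at most [p] from [c]: there [h c - h y <= K * p <= q]. *)
    pose y := Num.max a (c - p).
    have ay : a <= y by rewrite le_max lexx.
    have yc : y < c by rewrite gt_max ac; lra.
    have cyp : c - y <= p by rewrite lerBlDl -lerBlDr le_max lexx orbT.
    have := hy y; rewrite ay yc => /(_ isT).
    have := wK c y; rewrite [`|c - y|]ger0_norm ?subr_ge0 ?(ltW yc)// ler_norml => /andP[_].
    have := s_mono _ _ (ltW yc); rewrite -subr_ge0 => /(mulr_ge0 K0).
    have : 0 <= (L + r) * (c - y) by rewrite mulr_ge0 ?subr_ge0 ?addr_ge0 ?(ltW yc) ?(ltW r0).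
    have : 0 <= K * (p - (c - y)) by rewrite mulr_ge0 ?subr_ge0.
    by rewrite /h; lra.
rewrite /h => hba.
have sa : 0 <= s a by rewrite fine_ge0.
have sb : s b <= r by rewrite -lee_fin fineK// (le_trans (SU b))// ltW.
have : r * (b - a + K + 1) = e by rewrite /r mulfVK// gt_eqF.
have := ler_wpM2l K0 sb; have := mulr_ge0 K0 sa.
lra.
Qed.
End AlmostEverywhere.

(** * Chains of derivatives *)

Section Chains.
Context {R : realType}.
Implicit Types (w : R -> R) (G H : nat -> R -> R) (x t l L : R).

(** The pushforward under the reflection gives []a, b]] the length of [[c - b, c - a[], so
    uniqueness of Lebesgue measure applies. *)
Lemma lebesgue_measure_reflect (c : R) (A : set R) : measurable A ->
  lebesgue_measure [set x | A (c - x)] = lebesgue_measure A.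
Proof.
move=> mA.
have mf : measurable_fun [set: measurableTypeR R]
    ((fun x => c - x) : measurableTypeR R -> measurableTypeR R).
  by apply: measurable_funB.
have := @lebesgue_measure_unique R
  (pushforward lebesgue_measure ((fun x => c - x) : measurableTypeR R -> measurableTypeR R)) _ A mA.
move=> ->// _ [[a b]] _ <-.
rewrite /pushforward [X in _ = lebesgue_measure X](_ : _ = `[c - b, c - a[%classic).
  rewrite !lebesgue_measure_itv/= !lte_fin ltrD2l ltrN2; case: ifP => // _.
  by congr _%:E; ring.
by apply/seteqP; split => x /=; rewrite !in_itv/= => /andP[? ?]; apply/andP; split; lra.
Qed.

Lemma ae_reflect (c : R) (P : R -> Prop) :
  {ae lebesgue_measure, forall x, P x} ->
  {ae lebesgue_measure, forall x, P (c - x)}.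
Proof.
move=> [A [mA A0 NA]]; exists [set x | A (c - x)]; split => [||x /= nP].
- have mf : measurable_fun [set: measurableTypeR R]
      ((fun x => c - x) : measurableTypeR R -> measurableTypeR R).
    by apply: measurable_funB.
  by rewrite -[X in measurable X]setTI; exact: mf.
- by rewrite lebesgue_measure_reflect.
- exact: NA.
Qed.

(** Serves to discard the breakpoints of truncated functions. *)
Lemma ae_neq2 (a b : R) : {ae lebesgue_measure, forall x : R, x != a /\ x != b}.
Proof.
have N (r : R) : lebesgue_measure.-negligible [set r].
  by exists [set r]; split => //; exact: lebesgue_measure_set1.
apply: negligibleS (negligibleU (N a) (N b)) => x /=.
by move=> /not_andP[] /negP; rewrite negbK => /eqP ->; [left|right].
Qed.

Lemma ae_impl (P Q : R -> Prop) : (forall x, P x -> Q x) ->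
  {ae lebesgue_measure, forall x, P x} -> {ae lebesgue_measure, forall x, Q x}.
Proof. by move=> PQ; apply: negligibleS => x /= nQ /PQ. Qed.

Lemma ae_and (P Q : R -> Prop) : {ae lebesgue_measure, forall x, P x} ->
  {ae lebesgue_measure, forall x, Q x} ->
  {ae lebesgue_measure, forall x, P x /\ Q x}.
Proof.
move=> aP aQ; apply: negligibleS (negligibleU aP aQ) => x /=.
by move=> /not_andP[]; [left|right].
Qed.

(** A global Lipschitz constant replaces the almost everywhere bound on the derivative, because it
    is easier to preserve under constructions. It implies that bound by [derive_le_lip], and
    [ae_derive_le] gives the converse. *)
Definition lip_ae L w :=
  (forall x y, `|w x - w y| <= L * `|x - y|) /\
  {ae lebesgue_measure, forall x, derivable w x 1}.

Lemma derive_le_lip L w x l : (forall x y, `|w x - w y| <= L * `|x - y|) ->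
  is_derive x 1 w l -> `|l| <= L.
Proof.
move=> wL /is_derive_expansion h; apply/ler_addgt0Pr => e /h[d d0 dP].
have d2 : 0 < d / 2 by rewrite divr_gt0.
have := wL (x + d / 2) x; have := dP (x + d / 2) I.
rewrite (_ : x + d / 2 - x = d / 2); last by ring.
rewrite (gtr0_norm d2).
have -> : d / 2 < d by lra.
move=> /(_ isT) h1 h2; rewrite -(ler_pM2r d2).
rewrite (_ : (L + e) * (d / 2) = L * (d / 2) + e * (d / 2)); last by ring.
apply: le_trans (lerD h2 h1).
rewrite -[X in _ * X <= _](gtr0_norm d2) -normrM.
by rewrite -[X in `|X| <= _](subKr (w (x + d / 2) - w x)) ler_normB.
Qed.

Lemma lip_continuous L w : (forall x y, `|w x - w y| <= L * `|x - y|) ->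
  continuous w.
Proof.
move=> wL x; have L0 : 0 <= L.
  by have := wL 1 0; rewrite subr0 normr1 mulr1; apply: le_trans.
have L1 : 0 < L + 1 by lra.
apply/cvgrPdist_le => e e0; exists (e / (L + 1)); first by rewrite /= divr_gt0.
move=> y /= /ltW; rewrite ler_pdivlMr// => xy; apply: le_trans (wL _ _) _.
by rewrite (le_trans _ xy)// mulrC ler_wpM2l// lerDl.
Qed.

(* Signals are extended to the whole line, so that all derivatives involved in
   the constructions are two-sided. *)
Definition deriv_chain (m : nat) G :=
  forall i, (i < m)%N -> forall x, is_derive x 1 (G i) (G i.+1 x).

Definition lip_chain (m : nat) L G := deriv_chain m G /\ lip_ae L (G m).

(** Integrate [w] repeatedly, with the values [c i] as integration constants. *)
Lemma primitive_chain m w (c : nat -> R) : continuous w ->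
  exists G, [/\ deriv_chain m G, G m = w & forall i, (i < m)%N -> G i 0 = c i].
Proof.
elim: m w => [|m IH] w cw; first by exists (fun=> w).
have [F F0 dF] := primitive (c m) cw.
have [|G [dG Gm Gc]] := IH F.
  by move=> x; exact: is_derive_continuous (dF x).
exists (fun i => if (i <= m)%N then G i else w); split.
- move=> i im x; rewrite /= -ltnS im; move: im.
  rewrite ltnS leq_eqVlt => /predU1P[->|im]; first by rewrite ltnn Gm; exact: dF.
  by rewrite im; exact: dG.
- by rewrite /= ltnn.
- move=> i; rewrite ltnS => im; rewrite /= im; move: im.
  by rewrite leq_eqVlt => /predU1P[->|/Gc//]; rewrite Gm.
Qed.

Lemma lip_chainN m L G : lip_chain m L G -> lip_chain m L (fun i x => - G i x).
Proof.
move=> [dG [Gl Gae]]; split=> [i im x|]; first by apply: is_deriveN; exact: dG.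
split=> [x y|]; first by rewrite -opprD normrN Gl.
by apply: ae_impl Gae => x; exact: derivableN.
Qed.

Lemma lip_chain_reflect m L G (c : R) : lip_chain m L G ->
  lip_chain m L (fun i x => (-1) ^+ i * G i (c - x)).
Proof.
move=> [dG [Gl Gae]]; split=> [i im x|].
  have := is_derive_reflect (dG _ im (c - x)).
  move=> /(is_deriveZ ((-1) ^+ i)) h; apply: (is_derive_eq h).
  by rewrite exprS /GRing.scale/=; ring.
split=> [x y|].
  rewrite -mulrBr normrM normrX normrN1 expr1n mul1r (le_trans (Gl _ _))//.
  by rewrite (_ : c - x - (c - y) = - (x - y)) ?normrN//; ring.
apply: ae_impl (ae_reflect c Gae) => x /derivableP/is_derive_reflect.
by move=> /(is_deriveZ ((-1) ^+ m))[].
Qed.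

End Chains.

(** * Extension of signals to the whole line *)

Section Extension.
Context {R : realType}.
Implicit Types (f w : R -> R) (G H P : nat -> R -> R) (x t l L T : R).

(** A nonexpansive [p] into [A] keeps the Lipschitz constant that [w] has on [A]. Near almost every
    point [p] is constant or the identity, so the composite is locally a constant or [w] itself. *)
Lemma lip_ae_retract (A : set R) (p : R -> R) L w : 0 <= L ->
  (forall x, A (p x)) -> (forall x y, `|p x - p y| <= `|x - y|) ->
  (forall x y, A x -> A y -> `|w x - w y| <= L * `|x - y|) ->
  {ae lebesgue_measure, forall x, exists2 d : R, 0 < d &
    (forall y, `|y - x| < d -> p y = p x) \/
    ((forall y, `|y - x| < d -> p y = y) /\ derivable w x 1)} ->
  lip_ae L (fun x => w (p x)).
Proof.
move=> L0 Ap p1 wL wae; split=> [x y|].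
  by apply: le_trans (wL _ _ (Ap x) (Ap y)) _; rewrite ler_wpM2l.
apply: ae_impl wae => x [d d0 [px|[px /derivableP dw]]].
  have /(is_derive_near d0) : is_derive x 1 (cst (w (p x))) 0 by exact: is_derive_cst.
  by move=> /(_ (fun x => w (p x)))[] // y /px ->.
suff [] : is_derive x 1 (fun x => w (p x)) ('D_1 w x) by [].
by apply: (is_derive_near d0 _ dw) => y yd; rewrite px.
Qed.

Lemma deriv_chain_unique m T F G : deriv_chain m F -> deriv_chain m G ->
  (forall x, 0 <= x <= T -> F m x = G m x) ->
  (forall i, (i < m)%N -> F i 0 = G i 0) ->
  forall i x, (i <= m)%N -> 0 <= x <= T -> F i x = G i x.
Proof.
(* Downward induction from the top order, run on [j = m - i]: the difference at one order has
   derivative 0 by the previous case and vanishes at 0. *)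
move=> dF dG FGm FG0 i x im; rewrite -(subKn im); move: (m - i)%N (leq_subr i m) x => {im i}.
elim=> [|j IH] jm x xT; first by rewrite subn0 FGm.
have im : (m - j.+1 < m)%N by rewrite ltn_subrL (leq_trans _ jm).
have [x0 _] := andP xT.
pose a := (m - j.+1)%N.
have dFG y : y \in `[0, x] -> is_derive y 1 (F a - G a) (cst 0 y).
  rewrite in_itv/= => /andP[y0 yx].
  apply: (is_derive_eq (is_deriveB (dF _ im y) (dG _ im y))).
  rewrite subnSK// IH ?subrr// 1?ltnW// y0 (le_trans yx)//.
  by have [] := andP xT.
have FG0y y : y \in `[0, x] -> `|(cst 0 : R -> R) y| <= 0 by rewrite normr0.
have := derive_bound x0 dFG FG0y.
rewrite mul0r !fctE FG0// subrr subr0 normr_le0 subr_eq0 => /eqP; exact.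
Qed.

(** Freeze the top derivative outside [[0, T]] and integrate it [m] times from the values of [P] at
    0. This discards the behaviour of [P] beyond [T], where the Lipschitz bound may fail. *)
Lemma extend_chain m L T P : 0 <= L -> 0 < T -> deriv_chain m P ->
  {ae lebesgue_measure, forall x, derivable (P m) x 1} ->
  (forall x y, 0 <= x <= T -> 0 <= y <= T -> `|P m x - P m y| <= L * `|x - y|) ->
  exists2 F, lip_chain m L F &
    forall i x, (i <= m)%N -> 0 <= x <= T -> F i x = P i x.
Proof.
move=> L0 T0 dP aeP lipP; pose p (x : R) := Num.max 0 (Num.min x T).
have pT x : 0 <= p x <= T.
  by rewrite /p le_max lexx/= ge_max (ltW T0) ge_min lexx orbT.
have pid x : 0 <= x <= T -> p x = x.
  by move=> /andP[x0 xT]; rewrite /p min_l// max_r.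
have pl x : x <= 0 -> p x = 0.
  by move=> x0; rewrite /p max_l// ge_min x0.
have pr x : T <= x -> p x = T.
  by move=> xT; rewrite /p min_r// max_r// ltW.
have lw : lip_ae L (fun x => P m (p x)).
  apply: (@lip_ae_retract [set x | 0 <= x <= T]) => //.
  - have pP x : [\/ x <= 0 /\ p x = 0, (0 <= x /\ x <= T) /\ p x = x | T <= x /\ p x = T].
      have [x0|x0] := leP x 0; first by apply: Or31; rewrite pl.
      have [xT|xT] := leP x T; last by apply: Or33; rewrite pr// ltW.
      by apply: Or32; rewrite pid (ltW x0).
    move=> x y; have := ler_norm (x - y); have := ler_norm (y - x).
    rewrite distrC => ? ?; rewrite ler_norml; apply/andP.
    by split; case: (pP x) => [[? ->]|[[? ?] ->]|[? ->]];
      case: (pP y) => [[? ->]|[[? ?] ->]|[? ->]]; lra.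
  - apply: ae_impl (ae_and aeP (ae_neq2 0 T)) => x [dx [xn0 xnT]].
    have [x0|x0] := ltrP x 0.
      exists (- x); first by rewrite oppr_gt0.
      left=> y; rewrite ltr_norml => /andP[_ yx].
      by rewrite !pl//; lra.
    have {}x0 : 0 < x by rewrite lt_neqAle eq_sym xn0.
    have [xT|xT] := ltrP T x.
      exists (x - T); first by rewrite subr_gt0.
      left=> y; rewrite ltr_norml => /andP[yx _].
      by rewrite !pr//; lra.
    have {}xT : x < T by rewrite lt_neqAle xnT.
    exists (Num.min x (T - x)); first by rewrite lt_min x0 subr_gt0.
    right; split=> // y; rewrite lt_min !ltr_norml => /andP[/andP[? ?] /andP[? ?]].
    by apply: pid; apply/andP; split; lra.
have [F [dF Fm Fc]] := primitive_chain m (fun i => P i 0) (lip_continuous lw.1).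
exists F; first by split=> //; rewrite Fm.
by apply: deriv_chain_unique => // x xT; rewrite Fm pid.
Qed.

Lemma hderivenE m L G i x : lip_chain m L G -> (i <= m)%N -> 0 <= x ->
  hderiven i (G 0%N) x = G i x.
Proof.
move=> [dG _]; elim: i x => [//|i IH] x im x0.
rewrite /hderiven iterS -/(hderiven i (G 0%N)).
rewrite (@eq_hderive _ _ (G i))//; last by move=> s; apply: IH; exact: ltnW.
by have [] := hderive_expansion x0 (is_derive_expansion_ge0 (dG _ im x)).
Qed.

Lemma lip_chain_classF m L G : lip_chain m L G -> classF m L (G 0%N).
Proof.
move=> GL; have [dG [Gl Gae]] := GL.
have hG i : (i <= m)%N -> forall s, 0 <= s -> G i s = hderiven i (G 0%N) s.
  by move=> im s s0; rewrite (hderivenE GL).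
have hd t l : 0 <= t -> is_derive t 1 (G m) l ->
    hderivable (hderiven m (G 0%N)) t /\ hderiven m.+1 (G 0%N) t = l.
  move=> t0 dt; have [h1 h2] := hderive_expansion t0 (is_derive_expansion_ge0 dt).
  split; first by apply: eq_hderivable h1 => //; exact: hG.
  by rewrite -h2; apply: eq_hderive => // s s0; rewrite hG.
split; first split.
- move=> i t im t0; apply: (@eq_hderivable _ (G i)) => //; first by apply: hG; exact: ltnW.
  by have [] := hderive_expansion t0 (is_derive_expansion_ge0 (dG _ im t)).
- have : {within `[0, +oo[, continuous (G m)}.
    by apply: continuous_subspaceT; exact: lip_continuous Gl.
  apply: subspace_eq_continuous => s; rewrite inE/= in_itv/= andbT => s0.
  exact: hG.
- exists L => -[x y] [] /=; rewrite !in_itv/= !andbT => x0 y0.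
  by rewrite !(hderivenE GL)// Gl.
- apply: ae_impl Gae => t /derivableP dt t0; have [h1 h2] := hd _ _ t0 dt.
  by split=> //; rewrite h2; exact: derive_le_lip Gl dt.
Qed.

(** Freeze the derivative of order [m] at its initial value on the negative axis. By [ae_derive_le],
    used for it and its opposite, the almost everywhere bound improves the unknown constant [K] to
    [L]. Integrating [m] times recovers the derivatives of [f] on the half-line. *)
Lemma classF_lip_chain m L f : 0 <= L -> classF m L f ->
  exists2 G, lip_chain m L G &
    forall i x, (i <= m)%N -> 0 <= x -> hderiven i f x = G i x.
Proof.
move=> L0 [[df _ [K fK]] fae]; pose p (x : R) := Num.max x 0.
pose w x := hderiven m f (p x).
have p0 x : 0 <= p x by rewrite /p le_max lexx orbT.
have pl x : x <= 0 -> p x = 0 by move=> x0; rewrite /p max_r.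
have pr x : 0 <= x -> p x = x by move=> x0; rewrite /p max_l.
have {}fK x y : 0 <= x -> 0 <= y ->
    `|hderiven m f x - hderiven m f y| <= K * `|x - y|.
  by move=> x0 y0; apply: (fK (x, y)); rewrite /= !in_itv/= x0 y0.
have K0 : 0 <= K.
  by have := fK 1 0 ler01 (lexx _); rewrite subr0 normr1 mulr1; apply: le_trans.
have expw x l : 0 < x -> expansion `[0, +oo[ (hderiven m f) x l -> is_derive x 1 w l.
  move=> x0 /(expansion_ge0 x0)/is_derive_expansion; apply: (is_derive_near x0).
  by move=> y; rewrite ltr_norml /w => /andP[? _]; rewrite pr//; lra.
have wae : {ae lebesgue_measure, forall x, exists2 l, is_derive x 1 w l & `|l| <= L}.
  apply: ae_impl (ae_and fae (ae_neq2 0 0)) => x [hx [xn0 _]].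
  have [x0|x0] := ltrP x 0.
    exists 0; last by rewrite normr0.
    apply: (@is_derive_near _ (cst (w 0)) _ _ _ (- x)); first by rewrite oppr_gt0.
    move=> y; rewrite ltr_norml => /andP[_ ?].
    by rewrite /w !pl//; lra.
  have {}x0 : 0 < x by rewrite lt_neqAle eq_sym xn0.
  have [/hderivable_expansion h1 h2] := hx (ltW x0).
  by exists (hderiven m.+1 f x) => //; exact: expw.
have wK x y : `|w x - w y| <= K * `|x - y|.
  apply: le_trans (fK _ _ (p0 _) (p0 _)) _; rewrite ler_wpM2l//.
  have := ler_norm (x - y); have := ler_norm (y - x).
  rewrite distrC => ? ?; rewrite ler_norml; apply/andP.
  have pP z : (z <= 0 /\ p z = 0) \/ (0 <= z /\ p z = z).
    by have [z0|/ltW z0] := leP z 0; [left; rewrite pl|right; rewrite pr].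
  by split; case: (pP x) => [[? ->]|[? ->]]; case: (pP y) => [[? ->]|[? ->]]; lra.
have wLle x y : x <= y -> `|w x - w y| <= L * `|x - y|.
  move=> xy; rewrite distrC [`|x - y|]distrC [`|y - x|]ger0_norm ?subr_ge0//.
  rewrite ler_norml; apply/andP; split.
    rewrite lerNl; have := @ae_derive_le _ (fun x => - w x) K L x y L0 xy _ _.
    rewrite opprB opprK addrC; apply.
      by move=> s t; rewrite -opprD normrN wK.
    apply: ae_impl wae => s [l dl]; rewrite ler_norml => /andP[lL _].
    by exists (- l); [exact: is_deriveN|rewrite lerNl].
  apply: (ae_derive_le L0 xy wK); apply: ae_impl wae => s [l dl lL].
  by exists l => //; apply: le_trans lL; exact: ler_norm.
have wL x y : `|w x - w y| <= L * `|x - y|.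
  have [/wLle//|/ltW/wLle] := leP x y.
  by rewrite distrC [`|y - x|]distrC.
have [G [dG Gm Gc]] := primitive_chain m (fun i => hderiven i f 0) (lip_continuous wL).
exists G; first by do 2![split=> //]; rewrite Gm//; apply: ae_impl wae => x [l []].
move=> i x im; rewrite -(subKn im); move: (m - i)%N (leq_subr i m) x => {im i}.
elim=> [|j IH] jm x x0; first by rewrite subn0 Gm /w pr.
have im : (m - j.+1 < m)%N by rewrite ltn_subrL (leq_trans _ jm).
(* By induction [D] has derivative 0 on the half-line, one-sided at the origin, and [D 0 = 0] by the
   choice of integration constants. *)
pose D (s : R) := hderiven (m - j.+1) f s - G (m - j.+1)%N s.
have De t : 0 <= t -> expansion `[0, +oo[ D t 0.
  move=> t0 e e0; have e2 : 0 < e / 2 by rewrite divr_gt0.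
  have [d1 d10 h1] := hderivable_expansion (df _ _ im t0) e2.
  have [d2 d20 h2] := is_derive_expansion_ge0 (dG _ im t) e2.
  exists (Num.min d1 d2); first by rewrite lt_min d10.
  move=> y y0; rewrite lt_min => /andP[/h1-/(_ y0) {}h1 /h2-/(_ y0) {}h2].
  have E : hderive (hderiven (m - j.+1) f) t = G (m - j.+1).+1 t.
    by rewrite -[LHS]/(hderiven (m - j.+1).+1 f t) subnSK// IH// ltnW.
  rewrite -E in h2; rewrite (_ : e * _ = e / 2 * `|y - t| + e / 2 * `|y - t|); last by field.
  apply: le_trans (lerD h1 h2); apply: le_trans (ler_normB _ _).
  by rewrite le_eqVlt; apply/orP; left; apply/eqP; congr `|_|; rewrite /D; ring.
have := derive0_ge0_cst (De 0 (lexx _)) _ x0.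
rewrite /D Gc// subrr => h; apply/eqP; rewrite -subr_eq0; apply/eqP/h => t t0.
by apply/is_derive_expansion/expansion_ge0 => //; apply: De; exact: ltW.
Qed.

End Extension.

(** * Landau inequalities *)

Section Landau.
Context {R : realType}.
Implicit Types (G : nat -> R -> R) (x L N T : R).

(* Mean values over the two outer thirds of the interval give the factor
   [2 * 3 ^ i.+1] of the induction. *)
Lemma small_derivative_point i : exists2 A : R, 0 <= A &
  forall m G (a h N : R), (i <= m)%N -> deriv_chain m G -> 0 < h ->
    (forall x, a <= x <= a + h -> `|G 0%N x| <= N) ->
    exists2 x, a <= x <= a + h & `|G i x| <= A * N / h ^+ i.
Proof.
elim: i => [|i [A A0 IH]].
  exists 1 => // m G a h N _ _ h0 GN; exists a; first by rewrite lexx lerDl ltW.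
  by rewrite expr0 divr1 mul1r GN// lexx lerDl ltW.
exists (A * (2 * 3 ^+ i.+1)) => [|m G a h N im dG h0 GN].
  by rewrite mulr_ge0// mulr_ge0// exprn_ge0.
have h3 : 0 < h / 3 by rewrite divr_gt0.
have [|x1 /andP[ax1 x1a] Gx1] := IH m G a (h / 3) N (ltnW im) dG h3.
  by move=> x /andP[? ?]; apply: GN; apply/andP; split; lra.
have [|x2 /andP[ax2 x2a] Gx2] := IH m G (a + 2 * (h / 3)) (h / 3) N (ltnW im) dG h3.
  by move=> x /andP[? ?]; apply: GN; apply/andP; split; lra.
have x12 : x1 < x2 by lra.
have cG : {within `[x1, x2], continuous (G i)}.
  by apply: derivable_within_continuous => x _; have [] := dG _ im x.
have [c] := MVT x12 (fun x _ => dG _ im x) cG.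
rewrite in_itv/= => /andP[x1c cx2] E; exists c; first by apply/andP; split; lra.
have h' : h != 0 by rewrite gt_eqF.
pose B := A * N / (h / 3) ^+ i.
have -> : A * (2 * 3 ^+ i.+1) * N / h ^+ i.+1 = (B + B) / (h / 3).
  rewrite /B !exprS expr_div_n; field.
  by rewrite h'/= !expf_neq0.
rewrite ler_pdivlMr//; apply: (@le_trans _ _ `|G i x2 - G i x1|).
  by rewrite E normrM ler_wpM2l// ger0_norm; lra.
by apply: le_trans (ler_normB _ _) (lerD _ _).
Qed.

(** Start from the point of [small_derivative_point] and add the increment over a distance of at
    most [h]. The increment is controlled by the Lipschitz constant at order [m], and by the bound
    on the next derivative at lower orders. *)
Lemma landau m : exists2 C : R, 0 <= C &
  forall L G (a h N : R) i x, 0 <= L -> lip_chain m L G -> 0 < h ->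
    (forall x, a <= x <= a + h -> `|G 0%N x| <= N) ->
    (i <= m)%N -> a <= x <= a + h ->
    `|G i x| <= C * (N / h ^+ i + L * h ^+ (m - i).+1).
Proof.
(* The orders are treated downwards: stage [j] covers those from [m - j] to [m] with a common
   constant. *)
suff: forall j, (j <= m)%N -> exists2 C : R, 0 <= C &
  forall L G (a h N : R) i x, 0 <= L -> lip_chain m L G -> 0 < h ->
    (forall x, a <= x <= a + h -> `|G 0%N x| <= N) ->
    (i <= m)%N -> (m - j <= i)%N -> a <= x <= a + h ->
    `|G i x| <= C * (N / h ^+ i + L * h ^+ (m - i).+1).
  move=> /(_ m (leqnn _))[C C0 H]; exists C => // L G a h N i x L0 GL h0 GN im xa.
  by apply: H GN _ _ _ => //; rewrite subnn.
have dist (a h x y : R) : a <= x <= a + h -> a <= y <= a + h -> `|x - y| <= h.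
  move=> /andP[? ?] /andP[? ?]; rewrite ler_norml; apply/andP; split; lra.
have N0 G (a h N : R) : 0 < h ->
    (forall x, a <= x <= a + h -> `|G 0%N x| <= N) -> 0 <= N.
  by move=> h0 /(_ a); rewrite lexx lerDl ltW// => /(_ isT); apply: le_trans.
elim=> [|j IH] jm.
  have [A A0 AP] := small_derivative_point m.
  exists (A + 1); first by rewrite addr_ge0.
  move=> L G a h N i x L0 [dG [GL _]] h0 GN im; rewrite subn0 => mi xa.
  have -> : i = m by apply/eqP; rewrite eqn_leq im.
  have [y ya Gy] := AP m G a h N (leqnn _) dG h0 GN.
  rewrite subnn expr1 mulrDr mulrDl mul1r.
  have NH : 0 <= N / h ^+ m by rewrite divr_ge0 ?exprn_ge0 ?(N0 _ _ _ _ h0 GN) ?ltW.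
  have LH : 0 <= A * (L * h) by rewrite mulr_ge0// mulr_ge0// ltW.
  have := GL x y; have := ler_wpM2l L0 (dist _ _ _ _ xa ya).
  have : `|G m x| <= `|G m y| + `|G m x - G m y|.
    by rewrite -[X in `|X| <= _](subrKC (G m y)) ler_normD.
  by rewrite mulrDl mul1r; rewrite -mulrA in Gy; lra.
have [C C0 CP] := IH (ltnW jm).
have [A A0 AP] := small_derivative_point (m - j.+1).
(* [A] accounts for the value at the good point, [C] for the increment from there and for the orders
   already treated. *)
exists (A + C); first by rewrite addr_ge0.
move=> L G a h N i x L0 GL h0 GN im mi xa.
have N00 := N0 _ _ _ _ h0 GN.
have NH k : 0 <= N / h ^+ k by rewrite divr_ge0 ?exprn_ge0// ltW.
have LH k : 0 <= L * h ^+ k by rewrite mulr_ge0 ?exprn_ge0// ltW.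
have [mji|ij] := leqP (m - j)%N i.
  apply: le_trans (CP _ _ _ _ _ _ _ L0 GL h0 GN im mji xa) _.
  by rewrite ler_wpM2r ?addr_ge0// lerDr.
have {mi ij} iE : i = (m - j.+1)%N.
  by apply/eqP; rewrite eqn_leq mi andbT -ltnS subnSK.
have im1 : (i < m)%N by rewrite iE ltn_subrL (leq_trans _ jm).
have iS : i.+1 = (m - j)%N by rewrite iE subnSK.
have [dG _] := GL.
have := AP m G a h N _ dG h0 GN; rewrite -iE => /(_ im)[y ya Gy].
have Gxy : `|G i x - G i y| <= C * (N / h ^+ i.+1 + L * h ^+ (m - i.+1).+1) * h.
  wlog yx : x y xa ya {Gy} / y <= x => [H|].
    have [/H|/ltW /H] := leP y x; first exact.
    by rewrite distrC; exact.
  apply: le_trans (derive_bound (C := C * (N / h ^+ i.+1 + L * h ^+ (m - i.+1).+1)) yx (fun z _ => dG _ im1 z) _) _.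
    move=> z; rewrite in_itv/= => /andP[yz zx]; apply: CP GN _ _ _ => //.
      by rewrite iS.
    by move: xa ya => /andP[? ?] /andP[? ?]; apply/andP; split; lra.
  rewrite ler_wpM2l ?mulr_ge0 ?addr_ge0//.
  by apply: le_trans (dist _ _ _ _ xa ya); exact: ler_norm.
have : `|G i x| <= `|G i y| + `|G i x - G i y|.
  by rewrite -[X in `|X| <= _](subrKC (G i y)) ler_normD.
move=> /le_trans; apply; apply: le_trans (lerD Gy Gxy) _.
rewrite subnSK// (exprSr h (m - i)) (exprSr h i).
have h' : h != 0 by rewrite gt_eqF.
rewrite (_ : C * _ * h = C * (N / h ^+ i) + C * (L * (h ^+ (m - i) * h))); last first.
  by field; rewrite h' expf_neq0.
have := mulr_ge0 A0 (LH (m - i).+1); rewrite exprSr.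
by rewrite -!mulrA in Gy *; lra.
Qed.

End Landau.

(** * Signals with vanishing initial derivatives *)

Section Launching.
Context {R : realType}.
Implicit Types (G P F : nat -> R -> R) (x L N T C : R).

(* By Leibniz' rule, the chain of derivatives of [x / T * G 0 x]. *)
Definition ramp T G : nat -> R -> R :=
  fun i x => x / T * G i x + i%:R / T * G i.-1 x.

Lemma deriv_chain_ramp m T G : deriv_chain m G -> deriv_chain m (ramp T G).
Proof.
move=> dG i im x.
have dx : is_derive x 1 (T^-1 \*: (id : R -> R)) (T^-1 *: 1) by exact: is_deriveZ.
have h1 := is_deriveM dx (dG i im x).
have h2 : is_derive x 1 ((i%:R / T) \*: G i.-1) ((i%:R / T) *: G i x).
  case: i im {h1} => [|i] im; last by apply: is_deriveZ; exact: dG (ltnW im) x.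
  rewrite mul0r scale0r (_ : 0 \*: _ = cst 0); first exact: is_derive_cst.
  by apply/funext => y; rewrite /= scale0r.
have -> : ramp T G i = T^-1 \*: (id : R -> R) * G i + (i%:R / T) \*: G i.-1.
  by apply/funext => y; rewrite !fctE /ramp /GRing.scale/= [y / T]mulrC.
apply: (is_derive_eq (is_deriveD h1 h2)).
by rewrite /ramp /= /GRing.scale/= -natr1; ring.
Qed.

(** The Landau inequality is applied on a window of length 1, so the bound does not depend on
    [T]. *)
Lemma lip_chain_bounded m L N : 0 <= L -> exists2 C : R, 0 <= C &
  forall T G, 1 <= T -> lip_chain m L G ->
    (forall x, 0 <= x <= T -> `|G 0%N x| <= N) ->
    forall i x, (i <= m)%N -> 0 <= x <= T -> `|G i x| <= C.
Proof.
move=> L0; have [C C0 CP] := @landau R m.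
exists (C * (`|N| + L)) => [|T G T1 GL GN i x im /andP[x0 xT]].
  by rewrite mulr_ge0// addr_ge0.
(* The window [[a, a + 1]] contains [x] and is shifted left if needed to stay within [[0, T]]. *)
pose a := Num.min x (T - 1).
have ax : a <= x by rewrite /a ge_min lexx.
have xa : x <= a + 1 by rewrite /a -lerBlDr le_min; apply/andP; split; lra.
have a0 : 0 <= a by rewrite /a le_min x0 subr_ge0.
have aT : a + 1 <= T by rewrite -lerBrDr /a ge_min lexx orbT.
have GN1 y : a <= y <= a + 1 -> `|G 0%N y| <= N.
  by move=> /andP[? ?]; apply: GN; apply/andP; split; lra.
have := CP L G a 1 N i x L0 GL ltr01 GN1 im; rewrite ax xa => /(_ isT).
rewrite !expr1n divr1 mulr1 => /le_trans; apply.
by rewrite ler_wpM2l// lerD2r ler_norm.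
Qed.

(* Multiplying [n] times by [x / T] kills [n] derivatives at the origin and
   perturbs all bounds by [O(1 / T)] only. *)
Lemma ramped_chain n m L N : (0 < m)%N -> 0 <= L -> exists2 C : R, 0 <= C &
  forall T G, 1 <= T -> lip_chain m L G ->
    (forall x, 0 <= x <= T -> `|G 0%N x| <= N) ->
    exists P, [/\ deriv_chain m P,
      {ae lebesgue_measure, forall x, derivable (P m) x 1},
      (forall x, 0 <= x <= T -> `|P 0%N x| <= N),
      (forall i x, (i <= m)%N -> 0 <= x <= T -> `|P i x| <= C) &
      [/\ (forall x y, 0 <= x <= T -> 0 <= y <= T ->
            `|P m x - P m y| <= (L + C / T) * `|x - y|),
          (forall i, (i < n)%N -> P i 0 = 0) &
          (forall i, (i <= m)%N -> `|P i T - G i T| <= C / T)]].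
Proof.
move=> m0 L0; elim: n => [|n [C C0 IH]].
  have [C C0 CP] := @lip_chain_bounded m L N L0.
  exists C => // T G T1 GL GN; exists G; have [dG [Gl Gae]] := GL.
  have CT : 0 <= C / T by rewrite divr_ge0//; lra.
  split=> //; first by move=> i x; exact: CP.
  split=> // [x y _ _|i _]; last by rewrite subrr normr0.
  by apply: le_trans (Gl x y) _; rewrite ler_wpM2r// lerDl.
(* In the Lipschitz bound one [C / T] is inherited, one comes from the slope of the ramp and
   [m * C / T] from the Leibniz term. The other bounds fit in the same constant. *)
exists (C * (m%:R + 2)) => [|T G T1 GL GN].
  by rewrite mulr_ge0// addr_ge0.
have [P [dP Pae PN PC [Pl P0 PG]]] := IH T G T1 GL GN.
have T0 : 0 < T by lra.
have Tn0 : T != 0 by rewrite gt_eqF.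
have xT01 x : 0 <= x <= T -> 0 <= x / T <= 1.
  by move=> /andP[x0 xT]; rewrite divr_ge0 ?(ltW T0)//= ler_pdivrMr// mul1r.
have iT i : (i <= m)%N -> 0 <= i%:R / T :> R by rewrite divr_ge0// ltW.
have iTm i : (i <= m)%N -> i%:R / T <= m%:R / T :> R.
  by move=> im; rewrite ler_pM2r ?invr_gt0// ler_nat.
have mT : m%:R / T <= m%:R :> R by rewrite ler_pdivrMr// ler_peMr.
have second i x : (i <= m)%N -> 0 <= x <= T ->
    `|i%:R / T * P i.-1 x| <= m%:R / T * C.
  move=> im xT; rewrite normrM (ger0_norm (iT _ im)) ler_pM ?iT ?iTm//.
  by apply: PC => //; apply: leq_trans (leq_pred _) im.
have CT : 0 <= C / T by rewrite divr_ge0// ltW.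
exists (ramp T P); split.
- exact: deriv_chain_ramp.
- apply: ae_impl Pae => x dPm.
  have dm : derivable (P m.-1) x 1 by have [] := dP m.-1 (ltac:(by rewrite prednK)) x.
  have dx : derivable (T^-1 \*: (id : R -> R)) x 1 by apply: derivableZ; exact: derivable_id.
  have dmT : derivable ((m%:R / T) \*: P m.-1) x 1 by exact: derivableZ.
  have := derivableD (derivableM dx dPm) dmT.
  rewrite (_ : _ + _ = ramp T P m)//.
  by apply/funext => y; rewrite !fctE /ramp /GRing.scale/= [y / T]mulrC.
- move=> x xT; rewrite /ramp !mul0r addr0 normrM.
  have /andP[x0 x1] := xT01 _ xT.
  by rewrite (ger0_norm x0) (le_trans _ (PN x xT))// ler_piMl.
- move=> i x im xT; rewrite /ramp.
  have /andP[x0 x1] := xT01 _ xT.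
  apply: le_trans (ler_normD _ _) _.
  have := second i x im xT; have := PC i x im xT.
  have := ler_wpM2r C0 mT.
  have : `|x / T * P i x| <= `|P i x| by rewrite normrM (ger0_norm x0) ler_piMl.
  lra.
split.
- move=> x y xT yT; rewrite /ramp.
  have /andP[x0 x1] := xT01 _ xT.
  have m1m : (m.-1 < m)%N by rewrite prednK.
  have -> : x / T * P m x + m%:R / T * P m.-1 x - (y / T * P m y + m%:R / T * P m.-1 y)
    = x / T * (P m x - P m y) + (x - y) / T * P m y
      + m%:R / T * (P m.-1 x - P m.-1 y) by ring.
  have h1 : `|x / T * (P m x - P m y)| <= (L + C / T) * `|x - y|.
    rewrite normrM (ger0_norm x0) (le_trans _ (Pl x y xT yT))// ler_piMl//.
  have h2 : `|(x - y) / T * P m y| <= C / T * `|x - y|.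
    rewrite (_ : _ * P m y = P m y / T * (x - y)); last by ring.
    rewrite normrM ler_wpM2r// normrM normfV (gtr0_norm T0).
    by rewrite ler_pM2r ?invr_gt0// PC.
  have h3 : `|P m.-1 x - P m.-1 y| <= C * `|x - y|.
    wlog yx : x y xT yT {x0 x1 h1 h2} / y <= x => [H|].
      have [/H|/ltW /H] := leP y x; first exact.
      by rewrite distrC [`|x - y|]distrC; exact.
    rewrite [`|x - y|]ger0_norm ?subr_ge0//.
    apply: derive_bound yx (fun z _ => dP _ m1m z) _ => z.
    rewrite in_itv/= prednK// => /andP[yz zx]; apply: PC => //.
    by move: xT yT => /andP[? ?] /andP[? ?]; apply/andP; split; lra.
  have h4 : `|m%:R / T * (P m.-1 x - P m.-1 y)| <= m%:R / T * (C * `|x - y|).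
    by rewrite normrM (ger0_norm (iT _ (leqnn _))) ler_wpM2l// iT.
  apply: le_trans (ler_normD _ _) _; apply: le_trans (lerD (ler_normD _ _) h4) _.
  rewrite (_ : (L + C * (m%:R + 2) / T) * `|x - y| = (L + C / T) * `|x - y|
    + C / T * `|x - y| + m%:R / T * (C * `|x - y|)); last by field.
  by rewrite lerD2r lerD.
(* At 0 only the Leibniz term, a multiple of [P i.-1 0], can survive, so one more ramp kills one
   more derivative. *)
- move=> [|i] im; rewrite /ramp !mul0r add0r ?mul0r//=.
  by rewrite P0// mulr0.
- move=> i im; rewrite /ramp divff// mul1r.
  have TT : 0 <= T <= T by rewrite ltW/=.
  rewrite (_ : _ - _ = (P i T - G i T) + i%:R / T * P i.-1 T); last by ring.
  apply: le_trans (ler_normD _ _) _; have := PG i im; have := second i T im TT.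
  rewrite (_ : C * (m%:R + 2) / T = m%:R / T * C + 2 * (C / T)); last by field.
  lra.
Qed.

(** Use [m.+1] ramps to kill the orders 0 to [m] at the origin, scale by [L / (L + C / T)] to
    restore the Lipschitz constant [L] on [[0, T]], and extend from there. *)
Lemma launched_chain m L N : (0 < m)%N -> 0 < L -> exists2 C : R, 0 <= C &
  forall T G, 1 <= T -> lip_chain m L G ->
    (forall x, 0 <= x <= T -> `|G 0%N x| <= N) ->
    exists F, [/\ lip_chain m L F,
      (forall x, 0 <= x <= T -> `|F 0%N x| <= N),
      (forall i, (i <= m)%N -> F i 0 = 0) &
      (forall i, (i <= m)%N -> L / (L + C / T) * (G i T - C / T) <= F i T)].
Proof.
move=> m0 L0; have [C C0 CP] := @ramped_chain m.+1 m L N m0 (ltW L0).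
exists C => // T G T1 GL GN.
have [P [dP Pae PN PC [Pl P0 PG]]] := CP T G T1 GL GN.
have T0 : 0 < T by lra.
have CT : 0 <= C / T by rewrite divr_ge0// ltW.
have LC : 0 < L + C / T by lra.
pose r := L / (L + C / T).
have r0 : 0 <= r by rewrite divr_ge0// ltW.
have r1 : r <= 1 by rewrite ler_pdivrMr// mul1r lerDl.
have [||x y xT yT|F FL FP] := @extend_chain R m L T (fun i => r \*: P i) (ltW L0) T0.
- by move=> i im x; apply: is_deriveZ; exact: dP.
- by apply: ae_impl Pae => x; exact: derivableZ.
- rewrite /= /GRing.scale/= -mulrBr normrM (ger0_norm r0).
  apply: le_trans (ler_wpM2l r0 (Pl _ _ xT yT)) _.
  by rewrite mulrA /r divfK ?gt_eqF.
have T00 : 0 <= (0 : R) <= T by rewrite lexx ltW.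
exists F; split=> // [x xT|i im|i im].
- rewrite FP// /= /GRing.scale/= normrM (ger0_norm r0) (le_trans _ (PN x xT))//.
  by rewrite ler_piMl.
- by rewrite FP// /= P0// scaler0.
- rewrite FP ?lexx ?(ltW T0)//= /GRing.scale/= -/r ler_wpM2l//.
  by have := PG i im; rewrite ler_norml => /andP[]; lra.
Qed.

End Launching.

(** * Lower bounds on the worst-case error *)

Section WorstCase.
Context {R : realType}.
Implicit Types (G F : nat -> R -> R) (t x L N T C : R).

Lemma classF_inputs m L N f (eta : R -> R) : 0 <= L -> 0 <= N ->
  classF m L f -> noise N eta -> inputs (f \+ eta).
Proof. by move=> L0 N0 fF en; exists m, L, N; split=> //; exists f, eta. Qed.

(* With the noise cancelling the signal on [0, tau], the signals [G 0] and
   [- G 0] produce the same (zero) input there, hence the same output. *)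
Lemma worst_case_ge m (D : differentiator R m) (S : set (R -> R)) L N (k : 'I_m)
    G t tau : 0 <= L -> 0 <= N -> causal D -> S `<=` classF m L ->
  lip_chain m L G -> S (G 0%N) -> S (fun x => - G 0%N x) ->
  0 <= tau -> t <= tau -> (forall x, 0 <= x <= tau -> `|G 0%N x| <= N) ->
  (`|G k.+1 tau|%:E <= worst_case_error D S N k t)%E.
Proof.
move=> L0 N0 cD SF GL SG SNG tau0 ttau GN.
pose eta (x : R) := if 0 <= x <= tau then - G 0%N x else 0.
have etaN : noise N eta.
  by move=> x _; rewrite /eta; case: ifP => [/GN|_]; rewrite ?normrN ?normr0.
have NetaN : noise N (fun x => - eta x) by move=> x /etaN; rewrite normrN.
have ge f e : S f -> noise N e ->
    (`|hderiven k.+1 f tau - D (f \+ e) tau ord0 k|%:E <=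
      worst_case_error D S N k t)%E.
  move=> Sf eN; apply: le_trans (ereal_sup_ubound _); last by exists (f, e).
  by apply: ereal_sup_ubound; exists tau.
have := ge _ _ SG etaN; have := ge _ _ SNG NetaN.
have -> : D (G 0%N \+ eta) tau = D ((fun x => - G 0%N x) \+ (fun x => - eta x)) tau.
  apply: cD => //; try by apply: (classF_inputs L0 N0) => //; exact: SF.
  by move=> s st; rewrite /eta/= st opprK addrN addNr.
rewrite (hderivenE GL)// (hderivenE (lip_chainN GL))//.
(* The common output [y] is within the worst-case error of both [G k.+1 tau] and its opposite, which
   are [2 * |G k.+1 tau|] apart. *)
set y := D _ _ _ _; case: (worst_case_error _ _ _ _ _) => [M| |]; [|by rewrite !leey|by rewrite !leeNy_eq].
rewrite !lee_fin !ler_norml => /andP[? ?] /andP[? ?].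
by apply/andP; split; lra.
Qed.

Lemma lip_chain_gbar m L N T G (k : nat) : lip_chain m L G -> (k <= m)%N -> 0 <= T ->
  (forall x, 0 <= x <= T -> `|G 0%N x| <= N) -> ((G k T)%:E <= gbar m L N k T)%E.
Proof.
move=> GL km T0 GN; apply: ereal_sup_ubound; exists (G 0%N); last by rewrite (hderivenE GL).
by split=> //; exact: lip_chain_classF GL.
Qed.

Lemma gbar_le m L N T (k : nat) (M : \bar R) : 0 <= L -> 0 <= T -> (k <= m)%N ->
  (forall G, lip_chain m L G -> (forall x, 0 <= x <= T -> `|G 0%N x| <= N) ->
    ((G k T)%:E <= M)%E) ->
  (gbar m L N k T <= M)%E.
Proof.
move=> L0 T0 km H; apply: ge_ereal_sup => _ [g [gF gN] <-].
have [G GL gG] := classF_lip_chain L0 gF.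
rewrite gG//; apply: H => // x /andP[x0 xT].
by rewrite -gG// gN// x0.
Qed.

(** Two reflections compose to the translation by [T' - T], which carries the end point [T'] to [T];
    their signs cancel. *)
Lemma gbar_nonincreasing m L N (k : nat) T T' : 0 <= L -> (k <= m)%N ->
  0 <= T -> T <= T' -> (gbar m L N k T' <= gbar m L N k T)%E.
Proof.
move=> L0 km T0 TT'; apply: gbar_le => //; first exact: le_trans TT'.
move=> G GL GN.
have := lip_chain_gbar (lip_chain_reflect T (lip_chain_reflect T' GL)) km T0.
rewrite subrr subr0 signrMK; apply=> x /andP[x0 xT].
by rewrite !expr0 !mul1r GN//; apply/andP; split; lra.
Qed.

Lemma gbar_cvg m L N (k : nat) : 0 <= L -> (k <= m)%N ->
  exists2 l : \bar R, gbar m L N k T @[T --> +oo] --> l &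
    forall T, 0 <= T -> (l <= gbar m L N k T)%E.
Proof.
(* Freezing the argument below 0 makes [f] nonincreasing on the whole line and does not affect the
   limit. *)
move=> L0 km; pose f T := gbar m L N k (Num.max T 0).
exists (ereal_inf (range f)); last first.
  by move=> T T0; apply: ereal_inf_lbound; exists T => //; rewrite /f max_l.
have fni : nonincreasing_fun f.
  move=> x y xy; apply: gbar_nonincreasing => //; first by rewrite le_max lexx orbT.
  by rewrite ge_max !le_max xy lexx orbT.
apply: cvg_trans (nonincreasing_cvge fni); apply: near_eq_cvg.
by near do rewrite /f max_l//.
Unshelve. all: by end_near. Qed.

Lemma lip_chain0 m L : 0 <= L -> lip_chain m L (fun _ : nat => cst (0 : R)).
Proof.
move=> L0; split=> [i _ x|]; first exact: is_derive_cst.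
split=> [x y|]; first by rewrite subrr normr0 mulr_ge0.
by apply: (ae_impl _ (ae_neq2 0 0)) => x _; exact: derivable_cst.
Qed.

Lemma lip_chain_classFR m L (r : 'I_m.+1 -> R) G : lip_chain m L G ->
  (forall i : 'I_m.+1, `|G i 0| <= r i) -> classFR L r (G 0%N).
Proof.
move=> GL Gr; split; first exact: lip_chain_classF GL.
by move=> i; rewrite (hderivenE GL)// -ltnS.
Qed.

Lemma worst_case_classFR m (D : differentiator R m) (r : 'I_m.+1 -> R) L N
    (k : 'I_m) G t tau : 0 <= L -> 0 <= N -> causal D -> lip_chain m L G ->
  (forall i : 'I_m.+1, `|G i 0| <= r i) -> 0 <= tau -> t <= tau ->
  (forall x, 0 <= x <= tau -> `|G 0%N x| <= N) ->
  (`|G k.+1 tau|%:E <= worst_case_error D (classFR L r) N k t)%E.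
Proof.
move=> L0 N0 cD GL Gr; have SF : classFR L r `<=` classF m L by move=> f [].
apply: (worst_case_ge k L0 N0 cD SF GL).
- exact: lip_chain_classFR.
- by apply: (lip_chain_classFR (lip_chainN GL)) => i; rewrite normrN.
Qed.

(** For a finite error [M], a large horizon [T] gives [gbar m L N k.+1 T <= M + e]: by the Landau
    inequality alone if [L = 0], by launching signals from rest otherwise. *)
Lemma lim_gbar_le m (D : differentiator R m) (r : 'I_m.+1 -> R) L N
    (k : 'I_m) t (l : \bar R) : 0 <= L -> 0 <= N -> causal D ->
  (forall i, 0 <= r i) -> 0 <= t ->
  (forall T, 0 <= T -> (l <= gbar m L N k.+1 T)%E) ->
  (l <= worst_case_error D (classFR L r) N k t)%E.
Proof.
move=> L0 N0 cD r0 t0 lg.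
have m0 : (0 < m)%N by apply: leq_ltn_trans (ltn_ord k).
(* The zero signal excludes the value [-oo] and yields [0 <= M] below. *)
have : (0%:E <= worst_case_error D (classFR L r) N k t)%E.
  have := worst_case_classFR (tau := t) (t := t) (r := r) (N := N) k L0 N0 cD (lip_chain0 m L0).
  by rewrite normr0; apply.
have wG G T : lip_chain m L G -> (forall i, (i <= m)%N -> G i 0 = 0) -> 0 <= T -> t <= T ->
    (forall x, 0 <= x <= T -> `|G 0%N x| <= N) ->
    ((G k.+1 T)%:E <= worst_case_error D (classFR L r) N k t)%E.
  move=> GL G0 T0 tT GN.
  have := worst_case_classFR (r := r) k L0 N0 cD GL _ T0 tT GN.
  move=> /(_ (fun i => _)) h; apply: le_trans (h _); last first.
    by move=> i; rewrite G0 ?normr0// -ltnS.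
  by rewrite lee_fin ler_norm.
case: worst_case_error wG => [M| |] wG; [|by move=> _; rewrite leey|by rewrite leeNy_eq].
rewrite lee_fin => M0; apply/lee_addgt0Pr => e e0.
have [L_0|Lneq0] := eqVneq L 0.
  have [C C0 CP] := @landau R m.
  (* [1 <= T] bounds [T] by [T ^+ k.+1], and the second entry makes [C * N / T] at most [e]. *)
  pose T := Num.max 1 (C * N / e).
  have T1 : 1 <= T by rewrite le_max lexx.
  have T0 : 0 < T by lra.
  apply: le_trans (lg T (ltW T0)) _; apply: gbar_le => // [|G GL GN]; first exact: ltW.
  have GN0 x : 0 <= x <= 0 + T -> `|G 0%N x| <= N by rewrite add0r; exact: GN.
  have := CP L G 0 T N k.+1 T L0 GL T0 GN0 (ltn_ord k).
  rewrite add0r lexx (ltW T0) => /(_ isT).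
  rewrite {1}L_0 mul0r addr0 => GT; rewrite -EFinD lee_fin.
  apply: le_trans (ler_norm _) _; apply: le_trans GT _.
  apply: (@le_trans _ _ (C * N / T)).
    rewrite -mulrA ler_wpM2l// ler_wpM2l// lef_pV2 ?posrE ?exprn_gt0//.
    by rewrite -[leLHS]expr1 ler_weXn2l.
  apply: (@le_trans _ _ e); last by rewrite lerDr.
  by rewrite ler_pdivrMr// [e * T]mulrC -ler_pdivrMr// /T le_max lexx orbT.
have {Lneq0} Lgt0 : 0 < L by rewrite lt_neqAle eq_sym Lneq0.
have [C C0 CP] := @launched_chain R m L N m0 Lgt0.
(* Solving [L / (L + C / T) * (G k.+1 T - C / T) <= M] for [G k.+1 T] gives the bound
   [M + c / T]. *)
pose c := C * (M / L + 1).
have c0 : 0 <= c by rewrite mulr_ge0// addr_ge0// divr_ge0.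
pose T := Num.max (Num.max 1 t) (c / e).
have T1 : 1 <= T by rewrite /T !le_max lexx.
have tT : t <= T by rewrite /T !le_max lexx orbT.
have T0 : 0 < T by lra.
apply: le_trans (lg T (ltW T0)) _; apply: gbar_le => // [|G GL GN]; first exact: ltW.
have [F [FL FN F0 FG]] := CP T G T1 GL GN.
have CT : 0 <= C / T by rewrite divr_ge0// ltW.
have := wG F T FL F0 (ltW T0) tT FN; rewrite !lee_fin.
move=> /(le_trans (FG _ (ltn_ord k))).
rewrite mulrAC ler_pdivrMr ?ltr_wpDr// mulrC => GM.
have cT : c / T <= e by rewrite ler_pdivrMr// [e * T]mulrC -ler_pdivrMr// /T le_max lexx orbT.
rewrite -(ler_pM2r Lgt0).
have : c / T * L <= e * L by rewrite ler_pM2r.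
have -> : c / T * L = C / T * M + C / T * L.
  by rewrite /c; field; rewrite !gt_eqF.
lra.
Qed.

End WorstCase.

Theorem proposition4p6 (R : realType) (L N : R) (hL : 0 <= L) (hN : 0 <= N)
    (m : nat) (k : 'I_m) (D : differentiator R m) (hD : causal D) :
  [/\ (* a) *)
      cvg (gbar m L N k.+1 tau @[tau --> +oo%R]) /\
      (forall (r : 'I_m.+1 -> R) (t : R),
         (forall i, 0 <= r i) -> 0 <= t ->
         (lim (gbar m L N k.+1 tau @[tau --> +oo%R])
            <= worst_case_error D (classFR L r) N k t)%E),
      (* b) *)
      (forall (theta : R) (r : 'I_m.+1 -> R) (t : R),
         0 < theta -> (forall i, 0 <= r i) ->
         N <= r ord0 ->
         (forall i : 'I_m,
            (gbar m L N i.+1 theta <= (r (lift ord0 i))%:E)%E) ->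
         theta <= t ->
         (gbar m L N k.+1 t <= worst_case_error D (classFR L r) N k t)%E)
    & (* c) *)
      (forall t : R, 0 < t ->
         (gbar m L N k.+1 t <= worst_case_error D (classF m L) N k t)%E)].
Proof.
split.
- have [l gl lg] := @gbar_cvg R m L N k.+1 hL (ltn_ord k).
  split=> [|r t r0 t0]; first by apply/cvg_ex; exists l.
  by rewrite (cvg_lim _ gl)//; exact: lim_gbar_le.
- move=> theta r t theta0 r0 Nr gr thetat.
  have t0 : 0 <= t by rewrite (le_trans _ thetat)// ltW.
  apply: gbar_le => // G GL GN.
  (* Order 0 is bounded by [N]. At higher orders the reflection [H] and its opposite are both
     bounded by [N] on [[0, theta]], so [gbar] at [theta] controls both signs. *)
  have Gr (i : 'I_m.+1) : `|G i 0| <= r i.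
    have [j ->|->] := unliftP ord0 i; last by rewrite (le_trans _ Nr)// GN// lexx.
    have GNtheta x : 0 <= x <= theta -> `|G 0%N x| <= N.
      by move=> /andP[x0 xt]; rewrite GN// x0 (le_trans xt).
    pose H := fun (i : nat) x => (-1) ^+ i * G i (theta - x).
    have HL : lip_chain m L H by exact: lip_chain_reflect.
    have HN x : 0 <= x <= theta -> `|H 0%N x| <= N.
      by move=> /andP[? ?]; rewrite /H expr0 mul1r GNtheta//; apply/andP; split; lra.
    have Hj : H j.+1 theta <= r (lift ord0 j).
      by rewrite -lee_fin; apply: le_trans (gr j); exact: lip_chain_gbar (ltn_ord j) (ltW theta0) HN.
    have NHj : - H j.+1 theta <= r (lift ord0 j).
      rewrite -lee_fin; apply: le_trans (gr j).
      apply: (lip_chain_gbar (lip_chainN HL) (ltn_ord j) (ltW theta0)) => x xt.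
      by rewrite normrN HN.
    have -> : `|G (lift ord0 j) 0| = `|H j.+1 theta|.
      by rewrite /H subrr normrM normrX normrN1 expr1n mul1r.
    by rewrite ler_norml Hj andbT lerNl.
  apply: le_trans (worst_case_classFR k hL hN hD GL Gr t0 (lexx t) GN).
  by rewrite lee_fin ler_norm.
- move=> t t0; apply: gbar_le => // [|G GL GN]; first exact: ltW.
  apply: (@le_trans _ _ `|G k.+1 t|%:E); first by rewrite lee_fin ler_norm.
  exact: (worst_case_ge k hL hN hD (fun f Ff => Ff) GL (lip_chain_classF GL)
    (lip_chain_classF (lip_chainN GL)) (ltW t0) (lexx t) GN).
Qed.
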